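(* Let $m\ge 2$. The average, over all standard shifted tableaux $t$ of staircase shape $\Delta_m=(m,m-1,\ldots,1)$, of the number of braid hooks of $t$ equals $1$.
   Context: The shifted staircase diagram of shape $\Delta_m$ is the set of cells $(r,c)$ (row $r$, column $c$, rows numbered top to bottom, columns left to right) with $1\le r\le c\le m$. A standard shifted tableau of this shape is a bijective filling of the cells with $1,2,\ldots,m(m+1)/2$ that increases along each row from left to right and along each column from top to bottom. An integer $k$ is a braid hook of a tableau $t$ if there is a cell $(r,c)$ such that $t$ contains $k-1$ in cell $(r,c)$, $k$ in cell $(r,c+1)$, $k+1$ in cell $(r+1,c+1)$, and the cell $(r+1,c)$ does not belong to the diagram. *)

(* Defs.v *)
From mathcomp Require Import all_boot all_order all_algebra.

Set Implicit Arguments.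
Unset Strict Implicit.
Unset Printing Implicit Defensive.

(* Rows and columns are numbered from 1. *)
Definition in_staircase (m r c : nat) : bool := [&& 1 <= r, r <= c & c <= m].

Notation cell m := {x : 'I_m.+1 * 'I_m.+1 | in_staircase m x.1 x.2}.

Definition cell_row (m : nat) (x : cell m) : nat := (val x).1.
Definition cell_col (m : nat) (x : cell m) : nat := (val x).2.

Definition staircase_size (m : nat) : nat := (m * m.+1) %/ 2.

(* A filling may a priori take any value in {0, ..., m(m+1)/2};
   [bijective_filling] excludes the value 0. *)
Notation filling m := {ffun cell m -> 'I_(staircase_size m).+1}.

Definition entry (m : nat) (t : filling m) (x : cell m) : nat := t x.

Definition bijective_filling (m : nat) (t : filling m) : bool :=
  injectiveb t && (t @: [set: cell m] == [set k : 'I_(staircase_size m).+1 | 1 <= k]).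

Definition row_increasing (m : nat) (t : filling m) : bool :=
  [forall x : cell m, forall y : cell m,
    (cell_row x == cell_row y) && (cell_col x < cell_col y)
      ==> (entry t x < entry t y)].

Definition col_increasing (m : nat) (t : filling m) : bool :=
  [forall x : cell m, forall y : cell m,
    (cell_col x == cell_col y) && (cell_row x < cell_row y)
      ==> (entry t x < entry t y)].

Definition standard_shifted_tableaux (m : nat) : {set filling m} :=
  [set t | [&& bijective_filling t, row_increasing t & col_increasing t]].

Definition contains_at (m : nat) (t : filling m) (k r c : nat) : bool :=
  [exists x : cell m,
    [&& cell_row x == r, cell_col x == c & entry t x == k]].

(* Every cell (r, c) of the diagram has r, c <= m.  The truncation of [k.-1]
   at k = 0 is harmless, as a bijective filling never contains 0. *)
Definition braid_hook (m : nat) (t : filling m) (k : nat) : bool :=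
  [exists r : 'I_m.+1, exists c : 'I_m.+1,
    [&& contains_at t k.-1 r c, contains_at t k r c.+1,
        contains_at t k.+1 r.+1 c.+1 & ~~ in_staircase m r.+1 c]].

(* A braid hook is an entry of t, so k <= m(m+1)/2 loses nothing. *)
Definition num_braid_hooks (m : nat) (t : filling m) : nat :=
  #|[set k : 'I_(staircase_size m).+1 | braid_hook t k]|.

(* Main.v *)
Require Import Defs.
From mathcomp Require Import all_boot all_order all_algebra.
From mathcomp Require Import perm zify.

(* A tableau is a linear extension of the poset of cells; write c_k for the cell
   containing k.  The toggle tau_j exchanges j and j+1 when their cells are
   incomparable; it is an involution.  Let h_k be the cell containing k after
   tau_1, ..., tau_(k-1), and u_k the cell containing k after tau_(N-1), ...,
   tau_k (the fronts of promotion and of inverse promotion).  Applying both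
   tau_1, ..., tau_(k-2) and tau_(N-1), ..., tau_(k+1) is a permutation T_k of the
   tableaux, and T_k t contains k-1, k, k+1 in h_(k-1), c_k, u_(k+1).  So the total
   number of braid hooks is the number of pairs (t, k) such that T_k t has the
   braid hook k, and it is enough to see that each t admits exactly one such k.

   The cell h_k is maximal among those of entry <= k, and u_(k+1) is minimal among
   those of entry > k, so they never lie on the same diagonal.  Hence the sign of
   offset(h_k) - offset(u_(k+1)) can only change from k-1 to k if both fronts pass
   through c_k and h_(k-1), u_(k+1) are opposite corners of a 2x2 square; the fourth
   corner cannot be a cell, so c_k lies just right of a diagonal cell h_(k-1), the
   sign goes from - to +, and k is a braid hook of T_k t.  The sign is - at k = 1
   and + at k = N-1, so it changes exactly once. *)

Set Implicit Arguments.
Unset Strict Implicit.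
Unset Printing Implicit Defensive.

(** * Toggles on the linear extensions of a finite poset *)

Section Toggles.

Context (T : finType) (lt : rel T) (x0 : T) (N : nat).
Hypothesis card_T : #|T| = N.

Implicit Types (t s : {ffun T -> 'I_N.+1}) (x y z : T) (i j k : nat) (js : seq nat).

Definition linext : {set {ffun T -> 'I_N.+1}} :=
  [set t : {ffun T -> 'I_N.+1} | [&& injectiveb t, [forall x, 0 < t x]
             & [forall x, forall y, lt x y ==> (t x < t y)]]].

Definition at_label t k : T := odflt x0 [pick x | t x == k :> nat].

(** One direction of comparability suffices: in a linear extension the cell of [j.+1] never precedes
    that of [j]. *)
Definition toggle j t : {ffun T -> 'I_N.+1} :=
  if (0 < j < N) && ~~ lt (at_label t j) (at_label t j.+1)
  then [ffun x => tperm (inord j) (inord j.+1) (t x)] else t.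

Definition toggles js t := foldr toggle t js.

Lemma linextP t : reflect
  [/\ injective t, forall x, 0 < t x & forall x y, lt x y -> t x < t y]
  (t \in linext).
Proof.
rewrite inE; apply: (iffP and3P) => -[inj_t pos_t mono_t]; split.
- exact/injectiveP.
- exact/forallP.
- by move=> x y; exact/implyP/(forallP (forallP mono_t x)).
- exact/injectiveP.
- exact/forallP.
- by apply/'forall_forallP => x y; apply/implyP/mono_t.
Qed.

Lemma linext_image t : t \in linext -> t @: [set: T] = [set k : 'I_N.+1 | 0 < k].
Proof.
case/linextP=> inj_t pos_t _; apply/eqP; rewrite eqEcard.
apply/andP; split; first by apply/subsetP=> _ /imsetP[x _ ->]; rewrite inE.
rewrite card_imset // cardsT card_T.
suff -> : [set k : 'I_N.+1 | 0 < k] = [set~ ord0] by rewrite cardsC1 card_ord.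
by apply/setP=> k; rewrite !inE lt0n.
Qed.

Lemma at_labelP t k : t \in linext -> 0 < k <= N -> t (at_label t k) = k :> nat.
Proof.
move=> t_le /andP[k_gt0 le_kN]; rewrite /at_label; case: pickP => [x /eqP //|noX].
have := linext_image t_le => /setP/(_ (inord k)).
rewrite inE inordK // k_gt0 => /imsetP[x _ def_k].
by have := noX x; rewrite -def_k inordK // eqxx.
Qed.

Lemma at_label_eq t x : t \in linext -> at_label t (t x) = x.
Proof.
move=> t_le; have /linextP[inj_t pos_t _] := t_le.
by apply/inj_t/val_inj; rewrite /= at_labelP // pos_t -ltnS ltn_ord.
Qed.

Lemma val_tperm j (a : 'I_N.+1) : 0 < j < N ->
  tperm (inord j) (inord j.+1) a =
    (if a == j :> nat then j.+1 else if a == j.+1 :> nat then j else a) :> nat.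
Proof.
move=> /andP[j0 jN]; have vj : (inord j : 'I_N.+1) = j :> nat by rewrite inordK; lia.
have vj1 : (inord j.+1 : 'I_N.+1) = j.+1 :> nat by rewrite inordK; lia.
case: tpermP => [->|->|].
- by rewrite vj eqxx.
- by rewrite vj1 eqxx; case: eqP => // /eqP; lia.
- move=> /eqP n1 /eqP n2; rewrite -!val_eqE /= in n1 n2.
  by rewrite -vj (negbTE n1) vj -vj1 (negbTE n2).
Qed.

Lemma toggle_val j t x : toggle j t x =
  (if (0 < j < N) && ~~ lt (at_label t j) (at_label t j.+1) then
     if t x == j :> nat then j.+1 else if t x == j.+1 :> nat then j else t x
   else t x) :> nat.
Proof. by rewrite /toggle; case: ifP => // /andP[jN _]; rewrite ffunE val_tperm. Qed.

Lemma toggle_linext j t : t \in linext -> toggle j t \in linext.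
Proof.
move=> t_le; have /linextP[inj_t pos_t mono_t] := t_le.
rewrite /toggle; case: ifP => // /andP[jN nlt]; apply/linextP; split.
- by move=> x y; rewrite !ffunE => /perm_inj/inj_t.
- by move=> x; rewrite ffunE val_tperm //; have := pos_t x; repeat case: ifP; lia.
- move=> x y lt_xy; rewrite !ffunE !val_tperm //; have lt_t := mono_t _ _ lt_xy.
  case: (eqVneq (nat_of_ord (t x)) j) => [txj|]; last by repeat case: ifP; lia.
  case: (eqVneq (nat_of_ord (t y)) j.+1) => [tyj|]; last by repeat case: ifP; lia.
  by move: nlt; rewrite -{1}txj -tyj !at_label_eq ?lt_xy.
Qed.

Lemma toggles_linext js t : t \in linext -> toggles js t \in linext.
Proof. by move=> t_le; elim: js => //= j js; apply: toggle_linext. Qed.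

Lemma at_toggle j t : t \in linext -> 0 < j < N ->
  at_label (toggle j t) j =
    (if lt (at_label t j) (at_label t j.+1) then at_label t j else at_label t j.+1)
  /\ at_label (toggle j t) j.+1 =
    (if lt (at_label t j) (at_label t j.+1) then at_label t j.+1 else at_label t j).
Proof.
move=> t_le jN; have tog_le := toggle_linext j t_le.
have atj : t (at_label t j) = j :> nat by apply: at_labelP; lia.
have atj1 : t (at_label t j.+1) = j.+1 :> nat by apply: at_labelP; lia.
have tog x : toggle j t x = (if lt (at_label t j) (at_label t j.+1) then t x : nat else
    if t x == j :> nat then j.+1 else if t x == j.+1 :> nat then j else t x) :> nat.
  by rewrite toggle_val jN; case: lt.
have atE x k : toggle j t x = k :> nat -> at_label (toggle j t) k = x.
  by move=> <-; rewrite at_label_eq.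
by split; apply: atE; rewrite tog; case: lt => //; rewrite ?atj ?atj1 ?eqxx //;
   case: eqP => //; lia.
Qed.

Lemma toggle_inj j : {in linext &, injective (toggle j)}.
Proof.
suff tog2 : {in linext, forall t, toggle j (toggle j t) = t}.
  by move=> s t s_le t_le eq_st; rewrite -(tog2 s) // eq_st tog2.
move=> t t_le; have [jN|/negbTE jN] := boolP (0 < j < N); last first.
  by rewrite /toggle jN.
have [atj atj1] := at_toggle t_le jN.
have /linextP[_ _ mono_t] := t_le.
case lt_j: (lt (at_label t j) (at_label t j.+1)) atj atj1 => atj atj1.
  by rewrite /toggle lt_j !andbF lt_j andbF.
apply/ffunP=> x; apply/val_inj; rewrite /= [LHS]toggle_val atj atj1 jN /=.
(* After a swap the test sees the two cells in the opposite order, so it allows the second swap. *)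
rewrite (toggle_val j t) jN lt_j /=; case: ifP => [_|/negbFE/mono_t]; last first.
  by rewrite !at_labelP //; lia.
by repeat case: ifP; lia.
Qed.

Lemma toggles_inj js : {in linext &, injective (toggles js)}.
Proof.
elim: js => [|j js IHjs] //= s t s_le t_le /toggle_inj; rewrite !toggles_linext //.
by move=> /(_ isT isT); apply: IHjs.
Qed.

Lemma sum_toggles js (F : {ffun T -> 'I_N.+1} -> nat) :
  \sum_(t in linext) F (toggles js t) = \sum_(t in linext) F t.
Proof.
suff {2}<- : toggles js @: linext = linext by rewrite big_imset //; apply: toggles_inj.
apply/eqP; rewrite eqEcard card_in_imset ?leqnn ?andbT; last exact: toggles_inj.
by apply/subsetP=> _ /imsetP[s s_le ->]; apply: toggles_linext.
Qed.

(** [toggle j] moves only the labels [j] and [j.+1], so the set of cells of label at most [k] can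
    change only when [j = k]. *)
Lemma toggles_leq js t x k : k \notin js -> (toggles js t x <= k) = (t x <= k).
Proof.
elim: js => //= j js IHjs; rewrite inE negb_or => /andP[kj /IHjs <-].
by rewrite toggle_val; repeat case: ifP; lia.
Qed.

(** The cells of label at most [k] and those of label at most [k.-1] are both preserved, and they
    differ by the cell of [k]. *)
Lemma at_toggles js t k : t \in linext -> 0 < k <= N ->
  k \notin js -> k.-1 \notin js -> at_label (toggles js t) k = at_label t k.
Proof.
move=> t_le kN kjs k1js; have tog_le := toggles_linext js t_le.
suff tk : toggles js t (at_label t k) = k :> nat by rewrite -{1}tk at_label_eq.
have := toggles_leq t (at_label t k) kjs; have := toggles_leq t (at_label t k) k1js.
by rewrite at_labelP //; lia.
Qed.

Lemma toggleC i j t : t \in linext -> i.+1 < j ->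
  toggle i (toggle j t) = toggle j (toggle i t).
Proof.
move=> t_le lt_ij.
have [iN|/negbTE iN] := boolP (0 < i < N); last by rewrite /toggle iN.
have [jN|/negbTE jN] := boolP (0 < j < N); last by rewrite /toggle jN.
have at1 p k : k != p -> k.-1 != p -> 0 < k <= N ->
    at_label (toggle p t) k = at_label t k.
  by move=> kp k1p kN; rewrite -[toggle p t]/(toggles [:: p] t) at_toggles ?mem_seq1.
apply/ffunP=> x; apply/val_inj; rewrite /= (toggle_val i) (toggle_val j (toggle i t)).
rewrite !at1; try lia; rewrite !toggle_val; repeat case: ifP; lia.
Qed.

Lemma togglesC ks js t : t \in linext -> (forall i j, i \in ks -> j \in js -> i.+1 < j) ->
  toggles ks (toggles js t) = toggles js (toggles ks t).
Proof.
move=> t_le; elim: ks => //= i ks IHks far.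
rewrite IHks; last by move=> i' j i'_in; apply: far; rewrite inE i'_in orbT.
have {IHks far} : forall j, j \in js -> i.+1 < j.
  by move=> j; apply: far; rewrite mem_head.
elim: js => //= j js IHjs far; rewrite toggleC ?far ?mem_head ?IHjs //.
  by move=> j' j'_in; apply: far; rewrite inE j'_in orbT.
by rewrite toggles_linext ?toggles_linext.
Qed.

(** * The fronts of promotion and of inverse promotion *)

(* [toggle 0] is the identity, so this applies tau_1, ..., tau_(k-1), in this order. *)
Definition head_cell t k := at_label (toggles (rev (iota 0 k)) t) k.

(** [foldr] starts from the end of the list: tau_(N-1) acts first and tau_k last. *)
Definition tail_cell t k := at_label (toggles (iota k (N - k)) t) k.

Lemma head_leq t k : t \in linext -> 0 < k <= N -> t (head_cell t k) <= k.
Proof.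
move=> t_le kN; rewrite -(@toggles_leq (rev (iota 0 k))) ?mem_rev ?mem_iota; last by lia.
by rewrite at_labelP ?toggles_linext.
Qed.

Lemma tail_geq t k : t \in linext -> 0 < k <= N -> k <= t (tail_cell t k).
Proof.
move=> t_le kN; have := @toggles_leq (iota k (N - k)) t (tail_cell t k) k.-1.
by rewrite at_labelP ?toggles_linext // mem_iota; lia.
Qed.

(** Toggles of index below [k] keep the set of cells of label at most [k], and in the resulting
    linear extension the head cell has the largest label of that set. *)
Lemma head_max t k z : t \in linext -> 0 < k <= N -> t z <= k -> ~~ lt (head_cell t k) z.
Proof.
move=> t_le kN; rewrite -(@toggles_leq (rev (iota 0 k))) ?mem_rev ?mem_iota; last by lia.
have /linextP[_ _ mono] := toggles_linext (rev (iota 0 k)) t_le.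
by move=> le_k; apply/negP => /mono; rewrite at_labelP ?toggles_linext //; lia.
Qed.

Lemma tail_min t k z : t \in linext -> 0 < k <= N -> k <= t z -> ~~ lt z (tail_cell t k).
Proof.
move=> t_le kN; have /linextP[_ _ mono] := toggles_linext (iota k (N - k)) t_le.
have := @toggles_leq (iota k (N - k)) t z k.-1; rewrite mem_iota => /(_ ltac:(lia)).
by move=> eq_k le_k; apply/negP => /mono; rewrite at_labelP ?toggles_linext //; lia.
Qed.

Lemma head_cell1 t : head_cell t 1 = at_label t 1.
Proof. by []. Qed.

Lemma tail_cellN t : tail_cell t N = at_label t N.
Proof. by rewrite /tail_cell subnn. Qed.

(** The earlier toggles leave [k.+1] in place, so tau_k compares the front with the cell of [k.+1];
    if it swaps them, [k.+1] lands in the front, which stays. *)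
Lemma head_cellS t k : t \in linext -> 0 < k < N ->
  head_cell t k.+1 =
    if lt (head_cell t k) (at_label t k.+1) then at_label t k.+1 else head_cell t k.
Proof.
move=> t_le kN; rewrite {1}/head_cell -addn1 iotaD rev_cat add0n /= addn1.
have [_ ->] := at_toggle (toggles_linext (rev (iota 0 k)) t_le) kN.
rewrite (at_toggles t_le (k := k.+1)) ?mem_rev ?mem_iota //=; lia.
Qed.

Lemma tail_cellS t k : t \in linext -> 0 < k < N ->
  tail_cell t k =
    if lt (at_label t k) (tail_cell t k.+1) then at_label t k else tail_cell t k.+1.
Proof.
move=> t_le kN; rewrite {1}/tail_cell (_ : N - k = (N - k.+1).+1) /=; last by lia.
have [-> _] := at_toggle (toggles_linext (iota k.+1 (N - k.+1)) t_le) kN.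
rewrite (at_toggles t_le (k := k)) ?mem_iota //=; lia.
Qed.

Definition split_promotion k t :=
  toggles (rev (iota 0 k.-1)) (toggles (iota k.+1 (N - k.+1)) t).

Lemma at_split_promotion t k : t \in linext -> 1 < k < N ->
  [/\ at_label (split_promotion k t) k.-1 = head_cell t k.-1,
      at_label (split_promotion k t) k = at_label t k
    & at_label (split_promotion k t) k.+1 = tail_cell t k.+1].
Proof.
move=> t_le kN; split; last 2 first.
- by rewrite /split_promotion !at_toggles ?toggles_linext ?mem_rev ?mem_iota //; lia.
- by rewrite /split_promotion at_toggles ?toggles_linext ?mem_rev ?mem_iota //; lia.
(* The two blocks commute, and the one of larger indices, once moved last, does not affect the label
   [k.-1]. *)
rewrite /split_promotion togglesC //; last by move=> i j; rewrite mem_rev !mem_iota; lia.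
by rewrite at_toggles ?toggles_linext ?mem_iota //; lia.
Qed.

Lemma sum_split_promotion k (F : {ffun T -> 'I_N.+1} -> nat) :
  \sum_(t in linext) F (split_promotion k t) = \sum_(t in linext) F t.
Proof.
rewrite /split_promotion (sum_toggles _ (fun s => F (toggles (rev (iota 0 k.-1)) s))).
exact: sum_toggles.
Qed.

Lemma linext_nonempty (f : T -> nat) : (forall x y, lt x y -> f x < f y) -> 0 < #|linext|.
Proof.
move=> mono_f; pose le_f := relpre f leq; pose e := sort le_f (enum T).
have e_all x : x \in e by rewrite mem_sort mem_enum.
have size_e : size e = N by rewrite size_sort -cardE.
have idx x : (index x e).+1 < N.+1 by rewrite ltnS -size_e index_mem.
apply/card_gt0P; exists [ffun x => inord (index x e).+1]; apply/linextP; split.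
- move=> x y; rewrite !ffunE => /(congr1 val); rewrite /= !inordK // => -[].
  by apply: index_inj; rewrite ?e_all.
- by move=> x; rewrite ffunE inordK.
- move=> x y /mono_f lt_f; rewrite !ffunE !inordK // ltnS ltnNge; apply/negP=> le_yx.
  have: sorted le_f e by apply: sort_sorted => u v; apply: leq_total.
  move=> /sorted_leq_index/(_ _ _ (e_all y) (e_all x) le_yx) => H.
  suff : f y <= f x by lia.
  by apply: H => [u v w|u]; [apply: leq_trans | apply: leqnn].
Qed.

End Toggles.

(** * The staircase as a poset *)

Section Staircase.

Context (m : nat).

Local Notation N := (staircase_size m).
Local Notation row := (@cell_row m).
Local Notation col := (@cell_col m).

Implicit Types (t : filling m) (x y z : cell m) (k : nat).

Definition cell_lt : rel (cell m) :=
  [rel x y | [&& row x <= row y, col x <= col y & row x + col x < row y + col y]].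

Lemma cell_bounds x : [/\ 0 < row x, row x <= col x & col x <= m].
Proof. by have /and3P[] := valP x. Qed.

Lemma cell_inj x y : row x = row y -> col x = col y -> x = y.
Proof.
by case: x y => [[a b] p] [[c d] q] /= /val_inj ac /val_inj bd; apply/val_inj; congr pair.
Qed.

Lemma cell_ex r c : in_staircase m r c -> exists x, row x = r /\ col x = c.
Proof.
move=> rc; have /and3P[r0 lerc lecm] := rc.
have rcP : in_staircase m (inord r : 'I_m.+1) (inord c : 'I_m.+1) by rewrite !inordK //; lia.
pose x : cell m := Sub (inord r : 'I_m.+1, inord c : 'I_m.+1) rcP.
by exists x; rewrite /cell_row /cell_col SubK /= !inordK //; lia.
Qed.

Lemma card_cell : #|{: cell m}| = N.
Proof.
rewrite card_sig -sum1_card big_mkcond /=.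
rewrite -(pair_bigA _ (fun r c : 'I_m.+1 => if in_staircase m r c then 1 else 0)) /=.
have col_len (c : nat) : c <= m -> \sum_(r < m.+1) (if in_staircase m r c then 1 else 0) = c.
  move=> le_cm; transitivity (\sum_(1 <= r < c.+1) 1); last by rewrite sum_nat_const_nat; lia.
  rewrite -(big_mkord xpredT (fun r => if in_staircase m r c then 1 else 0)) -big_mkcond.
  rewrite big_ltn_cond //= (@big_cat_nat _ _ _ c.+1) //= [X in _ + X]big_nat_cond.
  rewrite [X in _ + X]big_pred0 ?addn0; last by move=> r; rewrite /in_staircase; lia.
  rewrite big_nat_cond [RHS]big_nat_cond; apply: eq_bigl => r; rewrite /in_staircase; lia.
rewrite exchange_big /=.
rewrite (eq_bigr (fun c : 'I_m.+1 => c : nat)); last by move=> c _; apply: col_len; rewrite -ltnS.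
by rewrite -(big_mkord xpredT id) bin2_sum bin2 /= mulnC -divn2.
Qed.

Lemma sst_linext : standard_shifted_tableaux m = linext cell_lt N.
Proof.
apply/setP=> t; rewrite [LHS]inE; apply/and3P/idP => [[]|t_le].
  move=> /andP[/injectiveP inj_t /eqP im_t] /'forall_forallP row_t /'forall_forallP col_t.
  apply/linextP; split=> // [x|x y /and3P[le_r le_c lt_rc]].
    by have := imset_f t (in_setT x); rewrite im_t inE.
  have [x_gt0 _ _] := cell_bounds x; have [_ le_y col_y] := cell_bounds y.
  (* The comparison passes through the corner in the row of [x] and the column of [y], a cell
     because [row x <= row y <= col y]. *)
  have [|z [row_z col_z]] := @cell_ex (row x) (col y); first by rewrite /in_staircase; lia.
  have le_xz : t x <= t z.
    have [lt_c|ge_c] := ltnP (col x) (col y).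
      by apply/ltnW/(implyP (row_t x z)); rewrite row_z col_z eqxx.
    by rewrite (@cell_inj x z) //; lia.
  have le_zy : t z <= t y.
    have [lt_r|ge_r] := ltnP (row x) (row y).
      by apply/ltnW/(implyP (col_t z y)); rewrite row_z col_z eqxx.
    by rewrite (@cell_inj z y) //; lia.
  rewrite ltn_neqAle (leq_trans le_xz le_zy) andbT; apply/eqP=> /val_inj/inj_t eq_xy.
  by rewrite eq_xy ltnn in lt_rc.
have im_t := linext_image card_cell t_le; have /linextP[inj_t _ mono_t] := t_le.
split; first by rewrite /bijective_filling im_t eqxx andbT; apply/injectiveP.
  by apply/'forall_forallP => x y; apply/implyP=> lt_xy; apply: mono_t; rewrite /cell_lt /=; lia.
by apply/'forall_forallP => x y; apply/implyP=> lt_xy; apply: mono_t; rewrite /cell_lt /=; lia.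
Qed.

(** The right neighbour of [x], or the lower one when [x] and [y] share a column, is a cell weakly
    between [x] and [y], hence [y] itself. *)
Lemma cell_cover x y : cell_lt x y -> (forall z, cell_lt x z -> cell_lt z y -> False) ->
  row y = row x /\ col y = (col x).+1 \/ row y = (row x).+1 /\ col y = col x.
Proof.
move=> lt_xy no_mid; have [x1 x2 x3] := cell_bounds x; have [y1 y2 y3] := cell_bounds y.
have [lt_c|ge_c] := ltnP (col x) (col y).
  have [|z [row_z col_z]] := @cell_ex (row x) (col x).+1; first by rewrite /in_staircase; lia.
  have := no_mid z; rewrite /cell_lt /= row_z col_z; move: lt_xy; rewrite /cell_lt /=; lia.
have [|z [row_z col_z]] := @cell_ex (row x).+1 (col x).
  by move: lt_xy; rewrite /in_staircase /cell_lt /=; lia.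
have := no_mid z; rewrite /cell_lt /= row_z col_z; move: lt_xy; rewrite /cell_lt /=; lia.
Qed.

(** * The offsets of the two fronts *)

Context (x0 : cell m).

Local Notation "t @ k" := (at_label x0 t k) (at level 20).
Local Notation head := (head_cell cell_lt x0).
Local Notation tail := (tail_cell cell_lt x0).
Local Notation L := (linext cell_lt N).

(** The diagonal of a cell; the subtraction does not truncate because [row x <= col x]. *)
Definition offset x := col x - row x.

Definition head_below_tail t k := offset (head t k) < offset (tail t k.+1).

Lemma linext_mono t x y : t \in L -> cell_lt x y -> t x < t y.
Proof. by case/linextP=> _ _; apply. Qed.

Lemma offset_head_tail t k : t \in L -> 0 < k < N -> offset (head t k) <> offset (tail t k.+1).
Proof.
move=> t_le kN; rewrite /offset.
have hk : t (head t k) <= k by apply: head_leq card_cell _ _ _ _; lia.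
have uk : k < t (tail t k.+1) by apply: tail_geq card_cell _ _ _ _; lia.
have h_max z : t z <= k -> ~~ cell_lt (head t k) z.
  by apply: head_max card_cell _ _ _ _ _; lia.
have u_min z : k < t z -> ~~ cell_lt z (tail t k.+1).
  by apply: tail_min card_cell _ _ _ _ _; lia.
move: (head t k) (tail t k.+1) hk uk h_max u_min => h u hk uk h_max u_min.
have [h1 h2 h3] := cell_bounds h; have [u1 u2 u3] := cell_bounds u => eq_off.
have nlt_uh : ~~ cell_lt u h by apply/negP=> /(linext_mono t_le); lia.
have neq : ~ (row h = row u /\ col h = col u).
  by case=> eq_r eq_c; rewrite (cell_inj eq_r eq_c) in hk; lia.
move: nlt_uh; rewrite /cell_lt /= => nlt_uh.
(* On a common diagonal [u] lies strictly below and right of [h], so the right neighbour of [h] is a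
   cell strictly between them; whatever its label, it contradicts [h_max] or [u_min]. *)
have [|z [row_z col_z]] := @cell_ex (row h) (col h).+1; first by rewrite /in_staircase; lia.
have [z_le|z_gt] := leqP (t z) k.
  by have := h_max z z_le; rewrite /cell_lt /= row_z col_z; lia.
by have := u_min z z_gt; rewrite /cell_lt /= row_z col_z; lia.
Qed.

Lemma contains_atE t k r c : t \in L -> 0 < k <= N ->
  contains_at t k r c = (row (t @ k) == r) && (col (t @ k) == c).
Proof.
move=> t_le kN; apply/existsP/andP => [[x /and3P[x_r x_c /eqP <-]]|[at_r at_c]].
  by rewrite /entry (@at_label_eq _ _ _ _ card_cell _ _ t_le).
by exists (t @ k); rewrite at_r at_c /entry (@at_labelP _ _ _ _ card_cell _ _ t_le) //=.
Qed.

(** The position below a cell is outside the diagram exactly when the cell is diagonal. *)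
Lemma braid_hookE t k : t \in L -> 1 < k < N ->
  braid_hook t k =
    [&& row (t @ k) == row (t @ k.-1), col (t @ k) == (col (t @ k.-1)).+1,
        row (t @ k.+1) == (row (t @ k.-1)).+1, col (t @ k.+1) == (col (t @ k.-1)).+1
      & row (t @ k.-1) == col (t @ k.-1)].
Proof.
move=> t_le kN; have [a1 a2 a3] := cell_bounds (t @ k.-1).
apply/existsP/idP => [[r /existsP[c]]|].
  rewrite !contains_atE //; try lia.
  case/and4P=> /andP[/eqP ar /eqP ac] /andP[/eqP-> /eqP->] /andP[/eqP-> /eqP->].
  by rewrite ar ac !eqxx /in_staircase /=; lia.
move=> hook; exists (val (t @ k.-1)).1; apply/existsP; exists (val (t @ k.-1)).2.
rewrite -/(row _) -/(col _) !contains_atE //; try lia.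
move: hook => /and5P[/eqP-> /eqP-> /eqP-> /eqP-> /eqP eq_rc].
by rewrite !eqxx -eq_rc /in_staircase ltnn andbF.
Qed.

Lemma braid_hook_bounds t k : t \in L -> braid_hook t k -> 1 < k < N.
Proof.
move=> /linextP[_ pos_t _] /existsP[r /existsP[c /and4P[/existsP[x hx] _ /existsP[y hy] _]]].
move: hx hy => /and3P[_ _ /eqP hx] /and3P[_ _ /eqP hy].
have : 0 < entry t x := pos_t x; have : entry t y < N.+1 := ltn_ord _; lia.
Qed.

(* [head_below_tail] stays true up to the unique k for which [split_promotion k t]
   has the braid hook k, and is false from there on. *)
Lemma hook_split_promotion t k : t \in L -> 0 < k -> k.+1 < N ->
  braid_hook (split_promotion cell_lt x0 k.+1 t) k.+1 + head_below_tail t k.+1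
    = head_below_tail t k.
Proof.
move=> t_le k_gt0 kN; have kN' : 1 < k.+1 < N by rewrite ltnS k_gt0.
have sp_le : split_promotion cell_lt x0 k.+1 t \in L.
  by rewrite !toggles_linext //; apply: card_cell.
rewrite braid_hookE // /head_below_tail.
have [-> -> ->] := @at_split_promotion _ _ x0 _ card_cell t k.+1 t_le kN'.
have off0 : offset (head t k) <> offset (tail t k.+1) by apply: offset_head_tail; lia.
have off1 : offset (head t k.+1) <> offset (tail t k.+2) by apply: offset_head_tail; lia.
have tx : t (t @ k.+1) = k.+1 :> nat by apply: (at_labelP _ card_cell t_le); lia.
have x_uniq z : t z = k.+1 :> nat -> z = t @ k.+1.
  by move=> <-; rewrite (@at_label_eq _ _ _ _ card_cell _ _ t_le).
have h_max z : t z <= k -> ~~ cell_lt (head t k) z.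
  by apply: head_max card_cell _ _ _ _ _; lia.
have u_min z : k.+1 < t z -> ~~ cell_lt z (tail t k.+2).
  by apply: tail_min card_cell _ _ _ _ _; lia.
move: off0 off1; rewrite /= (@head_cellS _ _ x0 _ card_cell t k t_le); last by lia.
rewrite (@tail_cellS _ _ x0 _ card_cell t k.+1 t_le); last by lia.
move: (head t k) (t @ k.+1) (tail t k.+2) tx x_uniq h_max u_min => h x u tx x_uniq h_max u_min.
(* A cell strictly between [h] and [u] has label above [k] by [h_max] and at most [k.+1] by
   [u_min]. *)
have mid_uniq z : cell_lt h z -> cell_lt z u -> z = x.
  move=> lt_hz lt_zu; apply: x_uniq; have := contraL (h_max z) lt_hz.
  by have := contraL (u_min z) lt_zu; lia.
have hx_cover : cell_lt h x ->
    row x = row h /\ col x = (col h).+1 \/ row x = (row h).+1 /\ col x = col h.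
  move=> lt_hx; apply: cell_cover => // z lt_hz /(linext_mono t_le).
  by have := contraL (h_max z) lt_hz; rewrite tx; lia.
have xu_cover : cell_lt x u ->
    row u = row x /\ col u = (col x).+1 \/ row u = (row x).+1 /\ col u = col x.
  move=> lt_xu; apply: cell_cover => // z /(linext_mono t_le) lt_xz lt_zu.
  by have := contraL (u_min z) lt_zu; rewrite tx in lt_xz; lia.
have [h1 h2 h3] := cell_bounds h; have [x1 x2 x3] := cell_bounds x.
have [u1 u2 u3] := cell_bounds u.
(* Here, as in the next case, at most one front moves, by one step: the difference of offsets
   changes by at most 1 and is nonzero before and after, so its sign is kept. *)
have [lt_hx|/negP nlt_hx] := boolP (cell_lt h x); last first.
  have -> : [&& row x == row h, col x == (col h).+1, row u == (row h).+1,
      col u == (col h).+1 & row h == col h] = false.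
    by apply/negP=> hook; apply: nlt_hx; rewrite /cell_lt /=; lia.
  case: ifP => [/xu_cover|_ _ _ //]; rewrite /offset; lia.
have [lt_xu|/negP nlt_xu] := boolP (cell_lt x u); last first.
  have -> : [&& row x == row h, col x == (col h).+1, row u == (row h).+1,
      col u == (col h).+1 & row h == col h] = false.
    by apply/negP=> hook; apply: nlt_xu; rewrite /cell_lt /=; lia.
  have := hx_cover lt_hx; rewrite /offset; lia.
have mid r c : in_staircase m r c -> row h <= r <= row u -> col h <= c <= col u ->
    row h + col h < r + c < row u + col u -> r = row x /\ c = col x.
  move=> /cell_ex[z [<- <-]] rz cz rcz.
  by rewrite (mid_uniq z) // /cell_lt /=; lia.
move: mid; rewrite /in_staircase /offset => mid _ _.
case: (hx_cover lt_hx) => [[rx cx]|[rx cx]]; case: (xu_cover lt_xu) => [[ru cu]|[ru cu]];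
  rewrite ?ru ?cu ?rx ?cx in x1 x2 x3 u1 u2 u3 mid *.
- by rewrite (_ : (row h == (row h).+1) = false) ?andbF /=; lia.
- have -> : row h == col h.
    (* The position below [h] would be a second cell between [h] and [u], so it is outside the
       diagram and [h] is diagonal. *)
    by have := mid (row h).+1 (col h); lia.
  by rewrite !eqxx /=; lia.
(* The position right of [h] is always a cell here, a second one between [h] and [u]:
   contradiction. *)
- by have := mid (row h) (col h).+1; lia.
- by rewrite (_ : ((row h).+1 == row h) = false) /=; lia.
Qed.

(** * Telescoping, and the sum over all tableaux *)

Hypothesis m_gt1 : 1 < m.

Lemma staircase_size_gt2 : 2 < N.
Proof. by rewrite /staircase_size leq_divRL // (@leq_mul 2 3). Qed.

(** Off the diagonal there is a cell to the left, whose label would have to be 0. *)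
Lemma offset_first t : t \in L -> offset (t @ 1) = 0.
Proof.
move=> t_le; have N_gt2 := staircase_size_gt2.
have: t (t @ 1) = 1 :> nat by apply: (at_labelP _ card_cell t_le); lia.
move: (t @ 1) => x tx; have [x1 x2 x3] := cell_bounds x.
apply/eqP; rewrite /offset subn_eq0 leqNgt; apply/negP=> lt_rc.
have [|z [row_z col_z]] := @cell_ex (row x) (col x).-1; first by rewrite /in_staircase; lia.
have /(linext_mono t_le) : cell_lt z x by rewrite /cell_lt /= row_z col_z; lia.
by rewrite tx; have /linextP[_ /(_ z) pos_t _] := t_le; rewrite ltnNge pos_t.
Qed.

(** Off the diagonal there is a cell below, whose label would exceed [N]. *)
Lemma offset_last t : t \in L -> offset (t @ N) = 0.
Proof.
move=> t_le; have N_gt2 := staircase_size_gt2.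
have: t (t @ N) = N :> nat by apply: (at_labelP _ card_cell t_le); lia.
move: (t @ N) => x tx; have [x1 x2 x3] := cell_bounds x.
apply/eqP; rewrite /offset subn_eq0 leqNgt; apply/negP=> lt_rc.
have [|z [row_z col_z]] := @cell_ex (row x).+1 (col x); first by rewrite /in_staircase; lia.
have /(linext_mono t_le) : cell_lt x z by rewrite /cell_lt /= row_z col_z; lia.
by rewrite tx ltnNge -ltnS ltn_ord.
Qed.

Lemma sum_hook_split_promotion t : t \in L ->
  \sum_(2 <= k < N) braid_hook (split_promotion cell_lt x0 k t) k = 1.
Proof.
move=> t_le; have N_gt2 := staircase_size_gt2.
have neg1 : head_below_tail t 1.
  (* The head front starts at offset 0 and the two offsets differ, so it is the smaller one. *)
  have := @offset_head_tail t 1 t_le (ltnW N_gt2).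
  by rewrite /head_below_tail head_cell1 offset_first //; lia.
have negN : head_below_tail t N.-1 = false.
  by rewrite /head_below_tail prednK ?tail_cellN ?offset_last //; lia.
suff tele n : 1 < n <= N ->
    \sum_(2 <= k < n) braid_hook (split_promotion cell_lt x0 k t) k + head_below_tail t n.-1 = 1.
  by have := tele N; rewrite negN addn0; apply; rewrite leqnn andbT; lia.
elim: n => // n IHn /andP[n_gt0 nN]; have [n_gt1|n_le1] := ltnP 1 n; last first.
  have -> : n = 1 by lia.
  by rewrite big_geq //= neg1.
rewrite big_nat_recr //= -addnA; case: n n_gt0 nN n_gt1 IHn => // n _ nN n_gt0 IHn.
by rewrite hook_split_promotion // IHn // n_gt0 ltnW.
Qed.

Lemma num_braid_hooksE t : t \in L -> num_braid_hooks t = \sum_(2 <= k < N) braid_hook t k.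
Proof.
move=> t_le; rewrite /num_braid_hooks -sum1_card big_mkcond /=.
rewrite (eq_bigr (fun k : 'I_N.+1 => braid_hook t k : nat)); last first.
  by move=> k _; rewrite inE; case: braid_hook.
rewrite -(big_mkord xpredT (fun k => braid_hook t k : nat)).
rewrite (@big_cat_nat _ _ _ 2) //=; last by have := staircase_size_gt2; lia.
rewrite [X in _ + X]big_nat_recr /=; last by have := staircase_size_gt2; lia.
have out k : ~~ (1 < k < N) -> braid_hook t k = false.
  by move=> /negP kN; apply/negbTE/negP=> /(braid_hook_bounds t_le)/kN.
rewrite [X in X + _]big_nat_cond [X in X + _]big1 => [|k kP]; last by rewrite out //; lia.
by rewrite (out N) ?ltnn ?andbF // addn0.
Qed.

(** With the sum over [k] outermost, each [k] can use its own permutation [split_promotion k]; after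
    exchanging back, each tableau contributes 1. *)
Lemma sum_num_braid_hooks : \sum_(t in L) num_braid_hooks t = #|L|.
Proof.
rewrite (eq_bigr _ num_braid_hooksE) exchange_big /=.
rewrite (eq_bigr (fun k => \sum_(t in L) braid_hook (split_promotion cell_lt x0 k t) k)).
  by rewrite exchange_big /= (eq_bigr _ sum_hook_split_promotion) sum1_card.
move=> k _.
by rewrite -(sum_split_promotion cell_lt x0 card_cell k (fun t => braid_hook t k : nat)).
Qed.

End Staircase.

Import GRing.Theory.
Local Open Scope ring_scope.

Theorem theorem1p3 (m : nat) (hm : (2 <= m)%N) :
  (\sum_(t in standard_shifted_tableaux m) (num_braid_hooks t)%:R)
    / #|standard_shifted_tableaux m|%:R = 1 :> rat.
Proof.
have [|x0 _] := @cell_ex m 1 1; first by rewrite /in_staircase; lia.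
rewrite sst_linext -natr_sum sum_num_braid_hooks // divff // Num.Theory.pnatr_eq0 -lt0n.
(* Row plus column increases along [cell_lt], so a tableau exists and the denominator is nonzero. *)
apply: (linext_nonempty (card_cell m) (f := fun x => (cell_row x + cell_col x)%N)).
by move=> x y /and3P[].
Qed.
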